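(* Let $R_{\mathrm{SB}}$ be the specialized $R$-matrix and $R_{\mathrm{FG}}$ the $R$-matrix for the Fock–Goncharov quiver, as defined in the context. Then $$\lim R_{\mathrm{SB}}=\beta(R_{\mathrm{FG}}),$$ where the limit is taken as $e_1\to-\infty$, $e_2=e_3\to-\infty$, $e_1-e_3\to-\infty$, with $e_i+d_i$ kept finite for $i=1,2,3$.
   Context: $q=\mathrm{e}^\hbar$; $\Psi_q(Y)=1/(-qY;q^2)_\infty$. Fock–Goncharov side: $\mathrm{p}_i,\mathrm{u}_i$ ($i=1,2,3$) satisfy $[\mathrm{p}_i,\mathrm{u}_j]=\hbar\delta_{ij}$, $[\mathrm{p}_i,\mathrm{p}_j]=[\mathrm{u}_i,\mathrm{u}_j]=0$, $\theta_1,\theta_2,\theta_3$ are parameters, and $$R_{\mathrm{FG}}=\Psi_q(\mathrm{e}^{\theta_1-\theta_3+\mathrm{p}_1+\mathrm{u}_1+\mathrm{p}_3-\mathrm{u}_3-\mathrm{p}_2})P_{\mathrm{FG}},\qquad P_{\mathrm{FG}}=\rho_{23}\,\mathrm{e}^{\frac1\hbar\mathrm{p}_1(\mathrm{u}_3-\mathrm{u}_2)}\,\mathrm{e}^{\frac{\theta_2-\theta_3}{\hbar}(\mathrm{u}_3-\mathrm{u}_1)},$$ $\rho_{23}$ exchanging the indices $2,3$ of the canonical variables (not of the parameters). Symmetric butterfly side: $\mathsf{u}_i,\mathsf{w}_i$ ($i=1,2,3$) satisfy $[\mathsf{u}_i,\mathsf{w}_j]=\hbar\delta_{ij}$, other commutators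 zero. Parameters $(a_i,b_i,c_i,d_i,e_i)$ satisfy $a_i+b_i+c_i+d_i+e_i=0$ and are specialized by $$e_2=e_3,\quad a_1=-a_3=c_3=-c_1,\quad a_2=c_2=0,\qquad \theta_1=-b_1,\quad\theta_2=-a_1-b_2,\quad\theta_3=d_3+e_3.$$ The $R$-matrix for the symmetric butterfly quiver is $$R=\Psi_q(\mathrm{e}^{-d_1-c_2-b_3+\mathsf{u}_1+\mathsf{u}_3+\mathsf{w}_1-\mathsf{w}_2+\mathsf{w}_3})^{-1}\Psi_q(\mathrm{e}^{-d_1-c_2-b_3-e_3+\mathsf{u}_1-\mathsf{u}_3+\mathsf{w}_1-\mathsf{w}_2+\mathsf{w}_3})^{-1}$$ $$\times\Psi_q(\mathrm{e}^{d_1+e_1+c_2+b_3+\mathsf{u}_1-\mathsf{u}_3-\mathsf{w}_1+\mathsf{w}_2-\mathsf{w}_3})\Psi_q(\mathrm{e}^{d_1+e_1+c_2+e_2+b_3+\mathsf{u}_1+2\mathsf{u}_2-\mathsf{u}_3-\mathsf{w}_1+\mathsf{w}_2-\mathsf{w}_3})P,$$ $$P=\mathrm{e}^{\frac1\hbar(\mathsf{u}_3-\mathsf{u}_2)\mathsf{w}_1}\mathrm{e}^{\frac{\lambda_0}{\hbar}(-\mathsf{w}_1-\mathsf{w}_2+\mathsf{w}_3)}\mathrm{e}^{\frac1\hbar(\lambda_1\mathsf{u}_1+\lambda_2\mathsf{u}_2+\lambda_3\mathsf{u}_3)}\rho_{23},$$ $\lambda_0=\frac{e_2-e_3}2$,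 $\lambda_1=a_2-a_3+b_2-b_3+\lambda_0$, $\lambda_2=-a_1-b_2+b_3-\lambda_0$, $\lambda_3=c_1-c_2+c_3$. $R_{\mathrm{SB}}$ denotes $R$ under the specialization $e_2=e_3$, $a_1=-a_3=c_3=-c_1$, $a_2=c_2=0$, $\theta_1=-b_1$, $\theta_2=-a_1-b_2$, $\theta_3=d_3+e_3$; explicitly, with $\Lambda=\theta_1-\theta_3=d_1+e_1+c_2+b_3$, $$R_{\mathrm{SB}}=\Psi_q(\mathrm{e}^{-\Lambda+e_1+\mathsf{u}_1+\mathsf{u}_3+\mathsf{w}_1-\mathsf{w}_2+\mathsf{w}_3})^{-1}\Psi_q(\mathrm{e}^{-\Lambda-e_3+e_1+\mathsf{u}_1-\mathsf{u}_3+\mathsf{w}_1-\mathsf{w}_2+\mathsf{w}_3})^{-1}$$ $$\times\Psi_q(\mathrm{e}^{\theta_1-\theta_3+\mathsf{u}_1-\mathsf{u}_3-\mathsf{w}_1+\mathsf{w}_2-\mathsf{w}_3})\Psi_q(\mathrm{e}^{\Lambda+e_2+\mathsf{u}_1+2\mathsf{u}_2-\mathsf{u}_3-\mathsf{w}_1+\mathsf{w}_2-\mathsf{w}_3})P_{\mathrm{SB}},\qquad P_{\mathrm{SB}}=\mathrm{e}^{\frac1\hbar(\mathsf{u}_3-\mathsf{u}_2)\mathsf{w}_1}\mathrm{e}^{\frac{\theta_3-\theta_2}{\hbar}(\mathsf{u}_1-\mathsf{u}_2)}\rho_{23}.$$ The isomorphism $\beta$ is $\mathrm{p}_i\mapsto-\mathsf{w}_i$,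 $\mathrm{u}_i\mapsto\mathsf{u}_i$ ($i=1,2,3$), applied to exponentials and to $P_{\mathrm{FG}}$ in the obvious way. The limit is taken formally, factor by factor in the power series expansions of $\Psi_q^{\pm1}$ (with $\theta_1,\theta_2,\theta_3$ fixed). *)

(* Defs.v *)
From HB Require Import structures.
From mathcomp Require Import all_boot all_order all_algebra.
From mathcomp Require Import complex.
From mathcomp Require Import all_classical all_reals all_analysis.

Set Implicit Arguments.
Unset Strict Implicit.
Unset Printing Implicit Defensive.

Import Order.TTheory GRing.Theory Num.Theory.
Import numFieldNormedType.Exports.

Local Open Scope classical_set_scope.
Local Open Scope ring_scope.

(* Typing R[i] as a numFieldType is what equips it with its topology. *)
Definition Cx (R : realType) : numFieldType := R[i]%C.

Definition cexp {R : realType} (z : Cx R) : Cx R :=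
  complex.Complex (expR (complex.Re z) * cos (complex.Im z))
                  (expR (complex.Re z) * sin (complex.Im z)).

(* One-variable formal power series sum_n a_n Y^n are coefficient sequences. *)

(* The coefficients of (z Y; p)_oo = prod_(j >= 0) (1 - z p^j Y): limits of the
   coefficients of the finite products, which exist for `|p| < 1. *)
Definition qpoch {R : realType} (z p : Cx R) : nat -> Cx R :=
  fun n => lim ((\prod_(j < N) (1 - (z * p ^+ j) *: 'X))`_n @[N --> \oo]).

(* The first n + 1 coefficients of 1 / a, from b_0 = 1 / a_0 and
   b_n = - (sum_(i < n) a_(n - i) b_i) / a_0. *)
Fixpoint fps_inv_seq {K : fieldType} (a : nat -> K) (n : nat) : seq K :=
  if n is m.+1 then
    let b := fps_inv_seq a m in
    rcons b (- (\sum_(i < n) a (n - i)%N * b`_i) / a 0%N)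
  else [:: (a 0%N)^-1].

Definition fps_inv {K : fieldType} (a : nat -> K) : nat -> K :=
  fun n => (fps_inv_seq a n)`_n.

Lemma size_fps_inv_seq (K : fieldType) (a : nat -> K) (n : nat) :
  size (fps_inv_seq a n) = n.+1.
Proof. by elim: n => //= n IHn; rewrite size_rcons IHn. Qed.

Lemma nth_fps_inv_seq (K : fieldType) (a : nat -> K) (n i : nat) :
  (i <= n)%N -> (fps_inv_seq a n)`_i = fps_inv a i.
Proof.
elim: n => [|n IHn]; first by rewrite leqn0 => /eqP ->.
rewrite leq_eqVlt => /predU1P [-> //|]; rewrite ltnS => le_in.
by rewrite /= nth_rcons size_fps_inv_seq ltnS le_in IHn.
Qed.

Lemma fps_invP (K : fieldType) (a : nat -> K) (n : nat) :
  a 0%N != 0 -> \sum_(i < n.+1) a (n - i)%N * fps_inv a i = (n == 0%N)%:R.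
Proof.
move=> a0; case: n => [|n]; first by rewrite big_ord1 mulfV.
rewrite big_ord_recr /= subnn {2}/fps_inv /= nth_rcons size_fps_inv_seq.
rewrite ltnn eqxx mulrCA mulfV // mulr1.
under eq_bigr => i _ do rewrite -(nth_fps_inv_seq a (n := n)) ?leq_ord //.
by rewrite subrr.
Qed.

(* The coefficients of Psi_q(Y) = 1 / (-qY; q^2)_oo. *)
Definition psi_q {R : realType} (q : Cx R) : nat -> Cx R :=
  fps_inv (qpoch (- q) (q ^+ 2)).

(* The algebra of formal exponentials in three canonical pairs x_i, y_i,
   [x_i, y_j] = hbar delta_ij.
   A linear form in the x_i, y_i is a column vector, the x_i first.
   Exponentials of the quadratic elements that occur, and permutations of the
   indices, act linearly by conjugation on the linear forms, and are
   represented by the matrix of this action.  Every formal exponential is then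
   a scalar multiple of a unique monomial e^v g, encoded as (v, g), and
     e^v g e^v' g' = e^([v, g v'] / 2) e^(v + g v') g g'
   by Baker-Campbell-Hausdorff.  An element of the completed algebra is a
   formal sum of monomials, i.e. a function giving the coefficients. *)

Definition lform (R : realType) := 'cV[Cx R]_(3 + 3).

Definition lact (R : realType) := 'M[Cx R]_(3 + 3).

Definition monom (R : realType) := (lform R * lact R)%type.

Definition series (R : realType) := monom R -> Cx R.

Definition canx {R : realType} (i : 'I_3) : lform R := delta_mx (lshift 3 i) 0.

Definition cany {R : realType} (i : 'I_3) : lform R := delta_mx (rshift 3 i) 0.

Definition sympl {R : realType} : lact R := block_mx 0 1%:M (- 1%:M) 0.

(* [v, v'] = hbar * omega v v' *)
Definition omega {R : realType} (v v' : lform R) : Cx R :=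
  (v^T *m sympl *m v') 0 0.

Definition mmul {R : realType} (m m' : monom R) : monom R :=
  (m.1 + m.2 *m m'.1, m.2 *m m'.2).

Definition mcoef {R : realType} (hbar : Cx R) (m m' : monom R) : Cx R :=
  cexp (hbar * omega m.1 (m.2 *m m'.1) / 2).

(* Coefficientwise a finite sum for all the products considered. *)
Definition smul {R : realType} (hbar : Cx R) (f g : series R) : series R :=
  fun m => \sum_(k \in [set k : monom R * monom R | mmul k.1 k.2 = m])
    mcoef hbar k.1 k.2 * f k.1 * g k.2.

Definition smonom {R : realType} (c : Cx R) (m : monom R) : series R :=
  fun m' => if m' == m then c else 0.

Definition sone {R : realType} : series R := smonom 1 (0, 1%:M).

Definition sprod {R : realType} (hbar : Cx R) (fs : seq (series R)) :
    series R :=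
  foldr (smul hbar) sone fs.

Definition spow {R : realType} (hbar : Cx R) (f : series R) (n : nat) :
    series R :=
  iter n (smul hbar f) sone.

(* sum_n a_n f^n *)
Definition seval {R : realType} (hbar : Cx R) (a : nat -> Cx R)
    (f : series R) : series R :=
  fun m => \sum_(n \in [set: nat]) a n * spow hbar f n m.

(* e^(s + v) *)
Definition sexp {R : realType} (s : Cx R) (v : lform R) : series R :=
  smonom (cexp s) (v, 1%:M).

(* e^(v v' / hbar), for omega v v' = 0: the operator
   ad (v v' / hbar) = v omega(v', _) + v' omega(v, _)
   on linear forms has square zero, hence its exponential is 1 + ad. *)
Definition sexp2 {R : realType} (v v' : lform R) : series R :=
  smonom 1 (0, 1%:M + v *m (v'^T *m sympl) + v' *m (v^T *m sympl)).

(* The exchange of the indices i and j of the canonical variables. *)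
Definition srho {R : realType} (i j : 'I_3) : series R :=
  smonom 1 (0, block_mx (tperm_mx i j) 0 0 (tperm_mx i j)).

Definition Psi {R : realType} (hbar s : Cx R) (v : lform R) : series R :=
  seval hbar (psi_q (cexp hbar)) (sexp s v).

Definition Psi_inv {R : realType} (hbar s : Cx R) (v : lform R) : series R :=
  seval hbar (fps_inv (psi_q (cexp hbar))) (sexp s v).

Definition o1 : 'I_3 := @Ordinal 3 0 isT.
Definition o2 : 'I_3 := @Ordinal 3 1 isT.
Definition o3 : 'I_3 := @Ordinal 3 2 isT.

(* Fock-Goncharov side: the canonical pairs are (p_i, u_i). *)

Definition P_FG {R : realType} (hbar : Cx R) (th : 'I_3 -> Cx R) : series R :=
  let p := @canx R in let u := @cany R in
  sprod hbar
    [:: srho o2 o3;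
        sexp2 (p o1) (u o3 - u o2);
        sexp 0 (((th o2 - th o3) / hbar) *: (u o3 - u o1))].

Definition R_FG {R : realType} (hbar : Cx R) (th : 'I_3 -> Cx R) : series R :=
  let p := @canx R in let u := @cany R in
  sprod hbar
    [:: Psi hbar (th o1 - th o3) (p o1 + u o1 + p o3 - u o3 - p o2);
        P_FG hbar th].

(* Symmetric butterfly side: the canonical pairs are (u_i, w_i). *)

Record bfly_params (R : realType) := BflyParams {
  pa : 'I_3 -> Cx R;
  pb : 'I_3 -> Cx R;
  pc : 'I_3 -> Cx R;
  pd : 'I_3 -> Cx R;
  pe : 'I_3 -> Cx R
}.

Definition balanced {R : realType} (z : bfly_params R) : Prop :=
  forall i, pa z i + pb z i + pc z i + pd z i + pe z i = 0.

Definition specialized {R : realType} (th : 'I_3 -> Cx R)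
    (z : bfly_params R) : Prop :=
  [/\ pe z o2 = pe z o3,
      [/\ pa z o1 = - pa z o3, - pa z o3 = pc z o3 & pc z o3 = - pc z o1],
      pa z o2 = 0 /\ pc z o2 = 0 &
      [/\ th o1 = - pb z o1, th o2 = - pa z o1 - pb z o2
        & th o3 = pd z o3 + pe z o3]].

Definition P_bfly {R : realType} (hbar : Cx R) (z : bfly_params R) :
    series R :=
  let u := @canx R in let w := @cany R in
  let a := pa z in let b := pb z in let c := pc z in let e := pe z in
  let l0 := (e o2 - e o3) / 2 in
  let l1 := a o2 - a o3 + b o2 - b o3 + l0 in
  let l2 := - a o1 - b o2 + b o3 - l0 in
  let l3 := c o1 - c o2 + c o3 in
  sprod hbar
    [:: sexp2 (u o3 - u o2) (w o1);
        sexp 0 ((l0 / hbar) *: (- w o1 - w o2 + w o3));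
        sexp 0 (hbar^-1 *: (l1 *: u o1 + l2 *: u o2 + l3 *: u o3));
        srho o2 o3].

Definition R_bfly_factors {R : realType} (hbar : Cx R) (z : bfly_params R) :
    seq (series R) :=
  let u := @canx R in let w := @cany R in
  let b := pb z in let c := pc z in let d := pd z in let e := pe z in
  [:: Psi_inv hbar (- d o1 - c o2 - b o3)
        (u o1 + u o3 + w o1 - w o2 + w o3);
      Psi_inv hbar (- d o1 - c o2 - b o3 - e o3)
        (u o1 - u o3 + w o1 - w o2 + w o3);
      Psi hbar (d o1 + e o1 + c o2 + b o3)
        (u o1 - u o3 - w o1 + w o2 - w o3);
      Psi hbar (d o1 + e o1 + c o2 + e o2 + b o3)
        (u o1 + u o2 *+ 2 - u o3 - w o1 + w o2 - w o3);
      P_bfly hbar z].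

Definition R_bfly {R : realType} (hbar : Cx R) (z : bfly_params R) :
    series R :=
  sprod hbar (R_bfly_factors hbar z).

(* The isomorphism p_i |-> - w_i, u_i |-> u_i.  On monomials it is
   (v, g) |-> (B v, B g B^-1), with B its matrix on linear forms. *)

Definition beta_mx {R : realType} : lact R := block_mx 0 1%:M (- 1%:M) 0.

Lemma beta_mx_p (R : realType) (i : 'I_3) :
  beta_mx *m canx i = - cany i :> lform R.
Proof.
apply/matrixP => k l; rewrite -[canx i]vsubmxK -[cany i]vsubmxK.
rewrite mul_block_col opp_col_mx !mul0mx add0r addr0 mul1mx mulNmx mul1mx.
congr (col_mx _ _ k l); apply/matrixP => k' l'; rewrite !mxE /=.
  by rewrite eq_lrshift eq_rlshift oppr0.
by rewrite eq_lshift eq_rshift.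
Qed.

Lemma beta_mx_u (R : realType) (i : 'I_3) :
  beta_mx *m cany i = canx i :> lform R.
Proof.
apply/matrixP => k l; rewrite -[canx i]vsubmxK -[cany i]vsubmxK.
rewrite mul_block_col !mul0mx add0r addr0 mul1mx mulNmx mul1mx.
congr (col_mx _ _ k l); apply/matrixP => k' l'; rewrite !mxE /=.
  by rewrite eq_lshift eq_rshift.
by rewrite eq_lrshift eq_rlshift oppr0.
Qed.

Lemma beta_mx_unit (R : realType) : (beta_mx : lact R) \in unitmx.
Proof.
suff /mulmx1_unit[] : beta_mx *m - beta_mx = 1%:M :> lact R by [].
rewrite mulmxN /beta_mx mulmx_block !mulmx0 !mul0mx !addr0 !add0r.
by rewrite mulmx1 mul1mx opp_block_mx !opprK oppr0 -scalar_mx_block.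
Qed.

(* The coefficient of beta f at m is that of f at beta^-1 m. *)
Definition beta {R : realType} (f : series R) : series R :=
  fun m => f (invmx beta_mx *m m.1, invmx beta_mx *m m.2 *m beta_mx).

(* Formal limits: coefficientwise, and factor by factor for a product. *)

Definition coef_lim {R : realType} {I : Type} (F : set_system I)
    (f : I -> series R) (l : series R) : Prop :=
  forall m, f t m @[t --> F] --> l m.

Definition factor_lim {R : realType} (hbar : Cx R) {I : Type}
    (F : set_system I) (fs : I -> seq (series R)) (l : series R) : Prop :=
  exists ls : seq (series R),
    [/\ forall t, size (fs t) = size ls,
        forall k, coef_lim F (fun t => nth sone (fs t) k) (nth sone ls k)
      & l = sprod hbar ls].

(* z tends to -oo, for complex parameters *)
Definition tends_ninfty {R : realType} {I : Type} (F : set_system I)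
    (z : I -> Cx R) : Prop :=
  complex.Re (z t) @[t --> F] --> -oo.

(* Main.v *)
Require Import Defs.
From HB Require Import structures.
From mathcomp Require Import all_boot all_order all_algebra.
From mathcomp Require Import perm complex ring.
From mathcomp Require Import all_classical all_reals all_analysis.
Import Order.TTheory GRing.Theory Num.Theory.
Import numFieldNormedType.Exports.
Local Open Scope classical_set_scope.
Local Open Scope ring_scope.

(* Every power of e^(s + v) is the monomial e^(n s) at (n v, 1), so each factor
   Psi_q^(+-1)(e^(s + v)) is a power series in e^s whose constant term is 1, and
   it tends to 1 when Re s -> -oo; the specialization makes this happen for all
   the factors but the third, which is constant, as is P.  For the product,
   every exponent v has u_1-coordinate 1, so the coefficient at a given monomial
   is a finite sum over a range that does not depend on the parameters.  Finally
   beta preserves the symplectic form, hence is multiplicative, and maps P_FG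
   to P: this amounts to moving rho_23 past the transvection and the
   exponential. *)

Set Implicit Arguments.
Unset Strict Implicit.
Unset Printing Implicit Defensive.

(** * The complex exponential and its decay as the real part tends to -oo *)

Section ComplexExponential.
Context {R : realType}.
Implicit Types z w : Cx R.

Lemma cexp0 : cexp 0 = 1 :> Cx R.
Proof. by rewrite /cexp /= expR0 cos0 sin0 mulr1 mulr0. Qed.

Lemma cexpD z w : cexp (z + w) = cexp z * cexp w.
Proof.
case: z w => [a b] [c d]; rewrite /cexp /= expRD cosD sinD.
apply/eqP; rewrite eq_complex /=; apply/andP; split; apply/eqP.
  by rewrite mulrBr; congr (_ - _); rewrite mulrACA.
rewrite mulrDr addrC; congr (_ + _); first by rewrite mulrACA.
by rewrite mulrACA.
Qed.

Lemma norm_cexp z : `|cexp z| = real_complex R (expR (complex.Re z)).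
Proof.
rewrite /cexp; rewrite [LHS]normc_def /=; congr (real_complex R _).
rewrite !exprMn -mulrDr cos2Dsin2 mulr1 sqrtr_sqr ger0_norm ?expR_ge0 //.
Qed.

Lemma cexp_cvg0 (I : Type) (F : set_system I) {FF : Filter F} (s : I -> Cx R) :
  tends_ninfty F s -> cexp (s t) @[t --> F] --> (0 : Cx R).
Proof.
move=> s_ninfty; apply/cvgr0Pnorm_lt => -[r i].
(* A positive element of [R[i]] has zero imaginary part, so the tolerance is a real r > 0; as e^s
   has norm e^(Re s), it suffices that Re s < ln r. *)
rewrite ltcE /= => /andP[/eqP i0 r0]; subst i.
move/cvgrNyPlt: s_ninfty => /(_ (ln r)).
apply: filterS => t st_lt; rewrite norm_cexp.
by rewrite ltcR -[ltRHS]lnK ?posrE // ltr_expR.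
Qed.

End ComplexExponential.

(** A sum over a classical set defaults to 0 when its support is infinite; a duplicate-free list
    covering the support gives finiteness and the value at once. *)
Lemma fsbig_uniq_seq (V : nmodType) (T : choiceType) (A : set T) (r : seq T)
    (f : T -> V) :
  uniq r -> {subset r <= A} -> (forall i, A i -> f i != 0 -> i \in r) ->
  \sum_(i \in A) f i = \sum_(i <- r) f i.
Proof.
move=> ur rA fr; rewrite (fsbig_seq _ _ ur); apply/esym/fsbig_widen => i /=.
  by move=> /rA; rewrite inE.
case=> Ai /negP ri; apply/eqP; apply: contraNT ri; exact: fr.
Qed.

(** * Transvections and their conjugation by isometries *)

Section Transvection.
Context {K : comNzRingType} {n : nat}.
Variable J : 'M[K]_n.
Implicit Types (v w : 'cV[K]_n) (S : 'M[K]_n).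

Lemma trmxN p q (M : 'M[K]_(p, q)) : (- M)^T = - M^T.
Proof. by apply/matrixP => i j; rewrite !mxE. Qed.

Definition isometry S := S^T *m J *m S = J.

(** For [J := sympl] this is the matrix in [sexp2], that is 1 + ad (v w / hbar). *)
Definition transvection v w :=
  1%:M + v *m (w^T *m J) + w *m (v^T *m J).

Lemma transvectionC v w : transvection v w = transvection w v.
Proof. by rewrite /transvection addrAC. Qed.

Lemma transvectionNN v w : transvection (- v) (- w) = transvection v w.
Proof. by rewrite /transvection !trmxN !mulNmx !mulmxN !opprK. Qed.

(** From S^T J S = J one gets (S w)^T J S = w^T J, so S carries the covector dual to w to the one
    dual to S w. *)
Lemma transvection_conj S v w : isometry S ->
  S *m transvection v w = transvection (S *m v) (S *m w) *m S.
Proof.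
move=> SS; rewrite /transvection !mulmxDr !mulmxDl mulmx1 mul1mx !trmx_mul.
have E u u' : S *m u *m (u'^T *m S^T *m J) *m S = S *m (u *m (u'^T *m J)).
  rewrite -(mulmxA _ (_ *m J)) -(mulmxA (u'^T)) -(mulmxA (u'^T)) SS.
  by rewrite -mulmxA.
by rewrite !E.
Qed.

(** Two successive conjugations; commutation then puts S last, where its inverse can cancel it. Used
    with S the matrix of beta and S' that of rho_23. *)
Lemma transvection_conjM S S' v w :
  isometry S -> isometry S' -> S *m S' = S' *m S ->
  S *m S' *m transvection v w =
  transvection (S *m (S' *m v)) (S *m (S' *m w)) *m S' *m S.
Proof.
move=> SS SS' comSS'; rewrite -mulmxA transvection_conj // mulmxA.
by rewrite transvection_conj // -!mulmxA comSS'.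
Qed.

End Transvection.

Lemma conj_mulmx (K : comUnitRingType) (n p : nat) (B A : 'M[K]_n)
    (C : 'M[K]_(n, p)) : B \in unitmx ->
  invmx B *m A *m B *m (invmx B *m C) = invmx B *m (A *m C).
Proof. by move=> uB; rewrite -!mulmxA mulKVmx. Qed.

(** With B the matrix of beta, the two conclusions compute the two components of the image under
    beta of the monomial [(S *m (T *m C), S *m T)]. *)
Lemma intertwine_conj (K : comUnitRingType) (n p : nat) (B S T T' : 'M[K]_n)
    (C : 'M[K]_(n, p)) : B \in unitmx -> B *m S *m T = T' *m S *m B ->
  B *m (S *m (T *m C)) = T' *m (S *m (B *m C)) /\
  B *m (S *m T) *m invmx B = T' *m S.
Proof.
move=> uB BST; split; first by rewrite !mulmxA BST.
by rewrite mulmxA BST mulmxK.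
Qed.

(** * Block form of the symplectic matrix *)

Section BlockMatrices.
Context {K : comNzRingType} {n : nat}.
Implicit Types A : 'M[K]_n.

(** For n = 3 both [sympl] and [beta_mx] are this matrix J, so that beta is symplectic because J^T =
    -J and J^2 = -1. *)
Definition std_sympl : 'M[K]_(n + n) := block_mx 0 1%:M (- 1%:M) 0.

Lemma trmx_std_sympl : std_sympl^T = - std_sympl.
Proof.
by rewrite tr_block_mx opp_block_mx trmxN !trmx0 !trmx1 oppr0 opprK.
Qed.

Lemma std_sympl_isometry : isometry std_sympl std_sympl.
Proof.
rewrite /isometry trmx_std_sympl /std_sympl opp_block_mx !mulmx_block.
by rewrite !(mulmx0, mul0mx, mulmx1, mulNmx, mulmxN, addr0, add0r, oppr0, opprK).
Qed.

Lemma block_diag_isometry A :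
  A^T *m A = 1%:M -> isometry std_sympl (block_mx A 0 0 A).
Proof.
move=> AA; rewrite /isometry tr_block_mx !mulmx_block !trmx0.
rewrite !(mulmx0, mul0mx, mulmx1, mulmxN, addr0, add0r, oppr0).
by rewrite mulNmx AA.
Qed.

Lemma std_sympl_block_diagC A :
  std_sympl *m block_mx A 0 0 A = block_mx A 0 0 A *m std_sympl.
Proof.
rewrite !mulmx_block !(mulmx0, mul0mx, mulmx1, mul1mx, addr0, add0r).
by rewrite mulNmx mulmxN mulmx1 mul1mx.
Qed.

End BlockMatrices.

(** * Products of monomials *)

Section Monomials.
Context {R : realType}.
Variable hbar : Cx R.
Implicit Types (v w : lform R) (m : monom R) (f g : Defs.series R) (A B : lact R).

Lemma omega0l v : omega 0 v = 0.
Proof. by rewrite /omega trmx0 !mul0mx mxE. Qed.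

Lemma omega0r v : omega v 0 = 0.
Proof. by rewrite /omega mulmx0 mxE. Qed.

Lemma omegaC v w : omega v w = - omega w v.
Proof.
suff E : v^T *m sympl *m w = - (w^T *m sympl *m v)^T by rewrite /omega E !mxE.
rewrite !trmx_mul trmxK (trmx_std_sympl : (@sympl R)^T = _).
by rewrite mulNmx mulmxN opprK mulmxA.
Qed.

Lemma omega_Mn v n : omega v (v *+ n) = 0.
Proof.
have omega_vv : omega v v = 0.
  by apply/eqP; rewrite -eqNr -omegaC.
elim: n => [|n IHn]; first by rewrite mulr0n omega0r.
by rewrite mulrS /omega mulmxDr mxE -!/(omega _ _) IHn omega_vv addr0.
Qed.

Lemma mmul1l m : mmul (0, 1%:M) m = m.
Proof. by case: m => v A; rewrite /mmul /= !mul1mx add0r. Qed.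

Lemma mcoef0l A m : mcoef hbar (0, A) m = 1.
Proof. by rewrite /mcoef omega0l mulr0 mul0r cexp0. Qed.

Lemma mcoef0r m A : mcoef hbar m (0, A) = 1.
Proof. by rewrite /mcoef mulmx0 omega0r mulr0 mul0r cexp0. Qed.

Lemma smonomM c c' m m' :
  smul hbar (smonom c m) (smonom c' m') =
  smonom (mcoef hbar m m' * c * c') (mmul m m').
Proof.
apply/funext => m0; rewrite /smul /smonom.
case: eqP => [->|m0_neq].
  rewrite (@fsbig_uniq_seq _ _ _ [:: (m, m')]) ?big_seq1 ?eqxx //.
    by move=> k; rewrite !inE => /eqP ->.
  move=> [k1 k2] _ /=; rewrite inE xpair_eqE.
  case: (k1 =P m) => _; last by rewrite mulr0 mul0r eqxx.
  by case: (k2 =P m') => _ //; rewrite mulr0 eqxx.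
rewrite fsbig1 // => -[k1 k2] /= k12.
case: eqP => k1m; last by rewrite mulr0 mul0r.
case: eqP => k2m; last by rewrite mulr0.
by case: m0_neq; rewrite -k12 k1m k2m.
Qed.

Lemma smonom_actM c c' v A B :
  smul hbar (smonom c (0, A)) (smonom c' (v, B)) =
  smonom (c * c') (A *m v, A *m B).
Proof. by rewrite smonomM mcoef0l mul1r /mmul /= add0r. Qed.

Lemma smonomM_act c c' v A B :
  smul hbar (smonom c (v, A)) (smonom c' (0, B)) =
  smonom (c * c') (v, A *m B).
Proof. by rewrite smonomM mcoef0r mul1r /mmul /= mulmx0 addr0. Qed.

(** The shape of [P_FG]; the next lemma treats the shape of the butterfly P. No
    Baker-Campbell-Hausdorff scalar appears, since only one factor has a nonzero linear form. *)
Lemma sprod_act_act_exp v A B :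
  sprod hbar [:: smonom 1 (0, A); smonom 1 (0, B); smonom 1 (v, 1%:M)] =
  smonom 1 (A *m (B *m v), A *m B).
Proof.
by rewrite /sprod /= /sone smonomM_act !smonom_actM !mulr1 !mulmx1.
Qed.

Lemma sprod_act_exp_act v A B :
  sprod hbar [:: smonom 1 (0, A); smonom 1 (v, 1%:M); smonom 1 (0, B)] =
  smonom 1 (A *m v, A *m B).
Proof.
rewrite /sprod /= /sone !smonomM_act smonom_actM !mulr1 !mulmx1.
by rewrite mul1mx.
Qed.

Lemma smul1l f : smul hbar sone f = f.
Proof.
apply/funext => m; rewrite /smul.
rewrite (@fsbig_uniq_seq _ _ _ [:: ((0, 1%:M), m)]) ?big_seq1 //=.
- by rewrite mcoef0l mul1r /sone /smonom eqxx mul1r.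
- by move=> k; rewrite !inE => /eqP -> /=; rewrite mmul1l.
move=> [k1 k2] /= k12; rewrite inE xpair_eqE /sone /smonom.
case: (k1 =P _) => [k1E|_]; last by rewrite mulr0 mul0r eqxx.
by move: k12; rewrite k1E mmul1l => ->; rewrite eqxx.
Qed.

(** Multiples of v commute with v, so every Baker-Campbell-Hausdorff scalar is 1. *)
Lemma spow_sexp s v n :
  spow hbar (sexp s v) n = smonom (cexp s ^+ n) (v *+ n, 1%:M).
Proof.
elim: n => [//|n IHn]; rewrite /spow iterS -/(spow _ _ _) IHn smonomM.
rewrite /mcoef /mmul /= !mul1mx omega_Mn mulr0 mul0r cexp0 mul1r.
by rewrite -exprS -mulrS.
Qed.

End Monomials.

(** * Grading by the u_1-coordinate *)

Section Grading.
Context {R : realType}.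
Variable hbar : Cx R.
Implicit Types (v w : lform R) (m : monom R) (f g : Defs.series R).

Definition lead v : Cx R := v (lshift 3 o1) 0.

Lemma leadD v w : lead (v + w) = lead v + lead w.
Proof. by rewrite /lead mxE. Qed.

Lemma leadN v : lead (- v) = - lead v.
Proof. by rewrite /lead mxE. Qed.

Lemma leadMn v n : lead (v *+ n) = lead v *+ n.
Proof.
elim: n => [|n IHn]; first by rewrite !mulr0n /lead mxE.
by rewrite !mulrS leadD IHn.
Qed.

Definition on_powers v f := forall m, f m != 0 -> exists n, m = (v *+ n, 1%:M).

(** The base c is complex because the exponent of P depends on theta and hbar, and its
    u_1-coordinate need not be an integer. *)
Definition lead_above (c : Cx R) f :=
  forall m, f m != 0 -> exists n : nat, lead m.1 = c + n%:R.

Lemma sone_on_powers v : on_powers v sone.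
Proof.
move=> m; rewrite /sone /smonom; case: (m =P _) => [-> _|].
  by exists 0%N.
by rewrite eqxx.
Qed.

Lemma smonom_lead_above c m : lead_above (lead m.1) (smonom c m).
Proof.
move=> m'; rewrite /smonom; case: (m' =P m) => [-> _|]; last by rewrite eqxx.
by exists 0%N; rewrite addr0.
Qed.

Lemma mulrn_inj v : lead v = 1 -> injective (fun n => (v *+ n, 1%:M) : monom R).
Proof.
move=> v1 i j [/(congr1 lead)]; rewrite !leadMn v1 => /eqP.
by rewrite eqr_nat => /eqP.
Qed.

(** The monomials of the powers of e^(s + v) are pairwise distinct, so only the n-th term of the
    series contributes. *)
Lemma seval_sexp_power a s v n : lead v = 1 ->
  seval hbar a (sexp s v) (v *+ n, 1%:M) = a n * cexp s ^+ n.
Proof.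
move=> v1; rewrite /seval (@fsbig_uniq_seq _ _ _ [:: n]) ?big_seq1 //=.
- by rewrite spow_sexp /smonom eqxx.
- by move=> k _; rewrite inE.
move=> k _; rewrite inE spow_sexp /smonom.
case: (_ =P (v *+ k, _)) => [nk _|]; last by rewrite mulr0 eqxx.
by rewrite (mulrn_inj v1 nk).
Qed.

Lemma seval_sexp_on_powers a s v : on_powers v (seval hbar a (sexp s v)).
Proof.
move=> m; apply: contraNP => m_pow; rewrite /seval fsbig1 // => n _.
rewrite spow_sexp /smonom; case: eqP => [mE|]; last by rewrite mulr0.
by case: m_pow; exists n.
Qed.

Lemma smul_lead_above c v f g :
  lead v = 1 -> on_powers v f -> lead_above c g -> lead_above c (smul hbar f g).
Proof.
move=> v1 fv gc m; apply: contraNP => mc; rewrite /smul fsbig1 // => -[k1 k2] /= k12.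
have [->|/fv [i k1E]] := eqVneq (f k1) 0; first by rewrite mulr0 mul0r.
have [->|/gc [j k2c]] := eqVneq (g k2) 0; first by rewrite mulr0.
case: mc; exists (i + j)%N; rewrite -k12 k1E /= mul1mx leadD leadMn v1 k2c.
by rewrite natrD addrCA.
Qed.

(* Only finitely many factorisations of a monomial contribute, because the
   coordinate [lead] strictly increases along the powers of e^v. *)
Lemma smul_on_powers c v m : lead v = 1 -> exists N : nat, forall f g,
  on_powers v f -> lead_above c g ->
  smul hbar f g m = \sum_(j < N)
    mcoef hbar (v *+ j, 1%:M) (m.1 - v *+ j, m.2) * f (v *+ j, 1%:M) *
    g (m.1 - v *+ j, m.2).
Proof.
move=> v1.
(* The bound is fixed before the series, so that one range serves a whole family of them. *)
have [N Nbound] : exists N : nat, forall g j, lead_above c g ->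
    g (m.1 - v *+ j, m.2) != 0 -> (j < N)%N.
  (* Splitting off e^(j v) from a monomial of lead c + d leaves lead c + d - j, which must lie in c
     + nat, whence j <= d. If the lead of m is not in c + nat, no splitting contributes and the
     range is empty. *)
  have [[d md]|md] := pselect (exists d : nat, lead m.1 = c + d%:R).
    exists d.+1 => g j gc /gc [n] /=; rewrite leadD leadN leadMn v1 md.
    move=> /eqP; rewrite subr_eq -addrA -natrD => /eqP /addrI /eqP.
    by rewrite eqr_nat => /eqP ->; rewrite ltnS leq_addl.
  exists 0%N => g j gc /gc [n] /=; rewrite leadD leadN leadMn v1.
  move=> /eqP; rewrite subr_eq -addrA -natrD => /eqP mE.
  by case: md; exists (n + j)%N.
exists N => f g fv gc; rewrite /smul.
pose k j : monom R * monom R := ((v *+ j, 1%:M), (m.1 - v *+ j, m.2)).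
rewrite (@fsbig_uniq_seq _ _ _ [seq k j | j <- iota 0 N]) ?big_map.
- by rewrite -(big_mkord xpredT (fun j => mcoef hbar (k j).1 (k j).2 *
    f (k j).1 * g (k j).2)) /index_iota subn0.
- rewrite map_inj_uniq ?iota_uniq // => i j [ij _].
  by apply: (mulrn_inj v1); congr pair.
- move=> _ /mapP[j _ ->]; rewrite inE /= /mmul /= !mul1mx addrC subrK.
  by case: (m).
move=> [k1 k2] /= k12.
have [->|/fv [j k1E]] := eqVneq (f k1) 0; first by rewrite mulr0 mul0r eqxx.
have [->|gk2] := eqVneq (g k2) 0; first by rewrite mulr0 eqxx.
have k2E : k2 = (m.1 - v *+ j, m.2).
  by rewrite -k12 k1E /mmul /= !mul1mx addrC addKr; case: (k2).
move=> _; rewrite k1E k2E; apply/mapP; exists j => //.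
by rewrite mem_iota /=; apply: (Nbound g); rewrite -?k2E.
Qed.

End Grading.

(** * Coefficientwise limits of products *)

Section Limits.
Context {R : realType}.
Variable hbar : Cx R.
Context {I : Type} (F : set_system I) {FF : Filter F}.

Lemma coef_lim_cst (f : Defs.series R) : coef_lim F (fun=> f) f.
Proof. by move=> m; exact: cvg_cst. Qed.

(** The support bounds travel with the convergence so that multiplication on the left by a further
    factor can be iterated. *)
Definition graded_lim c (ft : I -> Defs.series R) f :=
  [/\ forall t, lead_above c (ft t), lead_above c f & coef_lim F ft f].

(** At a fixed monomial the products and their limit are sums over one common finite range, so the
    limit is taken term by term. *)
Lemma graded_lim_smul c v (ft : I -> Defs.series R) f gt g :
  lead v = 1 -> (forall t, on_powers v (ft t)) -> on_powers v f ->
  coef_lim F ft f -> graded_lim c gt g ->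
  graded_lim c (fun t => smul hbar (ft t) (gt t)) (smul hbar f g).
Proof.
move=> v1 ftv fv ft_f [gtc gc gt_g]; split=> [t||m].
- exact: smul_lead_above v1 (ftv t) (gtc t).
- exact: smul_lead_above v1 fv gc.
have [N smulE] := smul_on_powers hbar c m v1.
rewrite smulE //; under eq_cvg do rewrite smulE //.
apply: (@cvg_big _ _ +%R 0 xpredT) => [x|j _]; first exact: add_continuous.
apply: cvgM; last exact: gt_g.
by apply: cvgM; [exact: cvg_cst|exact: ft_f].
Qed.

Lemma cvg_exprn (K : numFieldType) (f : I -> K) (l : K) n :
  f t @[t --> F] --> l -> f t ^+ n @[t --> F] --> l ^+ n.
Proof.
move=> fl; elim: n => [|n IHn]; first exact: cvg_cst.
rewrite exprS (eq_cvg _ _ (fun t => exprS (f t) n)).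
by apply: (cvgM fl IHn).
Qed.

(** The coefficient at n v is a_n e^(n s): it equals 1 for n = 0 and tends to 0 for n > 0. Off the
    multiples of v everything vanishes. *)
Lemma seval_sexp_cvg1 (a : nat -> Cx R) (s : I -> Cx R) v :
  a 0%N = 1 -> lead v = 1 -> tends_ninfty F s ->
  coef_lim F (fun t => seval hbar a (sexp (s t) v)) sone.
Proof.
move=> a0 v1 s_ninfty m.
have [[n ->]|mv] := pselect (exists n, m = (v *+ n, 1%:M)); last first.
  have -> : sone m = 0.
    by apply/eqP; apply: contra_notT mv => /(@sone_on_powers _ v).
  apply: cvg_near_cst; apply: nearW => t; apply/eqP.
  by apply: contra_notT mv => /seval_sexp_on_powers.
rewrite (eq_cvg _ _ (fun t => seval_sexp_power hbar a (s t) n v1)).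
case: n => [|n].
  apply: cvg_near_cst; apply: nearW => t.
  by rewrite expr0 mulr1 a0 /sone /smonom eqxx.
(* The limit 0 is written as the same expression in e^s, evaluated at e^s = 0. *)
have -> : sone (v *+ n.+1, 1%:M) = a n.+1 * 0 ^+ n.+1 :> Cx R.
  rewrite expr0n mulr0 /sone /smonom; case: eqP => // vn.
  by have := @mulrn_inj _ _ v1 n.+1 0%N vn.
apply: cvgM; first exact: cvg_cst.
apply: cvg_exprn; exact: cexp_cvg0.
Qed.

End Limits.

(** * Constant terms of the q-series *)

Section ConstantTerm.
Context {R : realType}.

Lemma fps_inv0 (K : fieldType) (a : nat -> K) : fps_inv a 0%N = (a 0%N)^-1.
Proof. by []. Qed.

(** Every finite product has constant term 1, so the limit is that of a constant sequence. *)
Lemma qpoch0 (x p : Cx R) : qpoch x p 0%N = 1.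
Proof.
rewrite /qpoch; apply: cvg_lim; first exact: norm_hausdorff.
apply: cvg_near_cst; apply: nearW => N.
elim: N => [|N IHN]; first by rewrite big_ord0 coef1.
by rewrite big_ord_recr /= coef0M IHN mul1r coefB coef1 coefZ coefX mulr0 subr0.
Qed.

Lemma psi_q0 (q : Cx R) : psi_q q 0%N = 1.
Proof. by rewrite /psi_q fps_inv0 qpoch0 invr1. Qed.

End ConstantTerm.

(** * Symplectic matrices: beta and the exchange of indices *)

Section Symplectic.
Context {R : realType}.
Implicit Types (v w : lform R) (S : lact R).

Local Notation symplectic := (isometry (@sympl R)).

Lemma omega_symplectic S v w : symplectic S -> omega (S *m v) (S *m w) = omega v w.
Proof.
by move=> SS; rewrite /omega -[in RHS]SS trmx_mul !mulmxA.
Qed.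

Lemma symplectic_beta : symplectic beta_mx.
Proof. exact: std_sympl_isometry. Qed.

Definition rho_mx (i j : 'I_3) : lact R :=
  block_mx (tperm_mx i j) 0 0 (tperm_mx i j).

Lemma symplectic_rho i j : symplectic (rho_mx i j).
Proof.
apply: block_diag_isometry.
by rewrite tr_perm_mx tpermV -perm_mxM tperm2 perm_mx1.
Qed.

Lemma rho_betaC i j : beta_mx *m rho_mx i j = rho_mx i j *m beta_mx.
Proof. exact: std_sympl_block_diagC. Qed.

Lemma tperm_mx_delta (i j k : 'I_3) :
  tperm_mx i j *m delta_mx k 0 = delta_mx (tperm i j k) 0 :> 'cV[Cx R]_3.
Proof.
rewrite -xrowE; apply/matrixP => l c; rewrite !mxE.
by rewrite -(inj_eq (@perm_inj _ (tperm i j))) tpermK.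
Qed.

Lemma canxE i : canx i = col_mx (delta_mx i 0) 0 :> lform R.
Proof.
apply/colP => k; rewrite !mxE; case: splitP => l kl; rewrite !mxE.
  by rewrite (_ : k = lshift 3 l) ?eq_lshift //; exact: val_inj.
by rewrite (_ : k = rshift 3 l) ?eq_rlshift //; exact: val_inj.
Qed.

Lemma canyE i : cany i = col_mx 0 (delta_mx i 0) :> lform R.
Proof.
apply/colP => k; rewrite !mxE; case: splitP => l kl; rewrite !mxE.
  by rewrite (_ : k = lshift 3 l) ?eq_lrshift //; exact: val_inj.
by rewrite (_ : k = rshift 3 l) ?eq_rshift //; exact: val_inj.
Qed.

Lemma rho_canx i j k : rho_mx i j *m canx k = canx (tperm i j k) :> lform R.
Proof.
by rewrite !canxE mul_block_col !mul0mx mulmx0 !addr0 tperm_mx_delta.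
Qed.

Lemma rho_cany i j k : rho_mx i j *m cany k = cany (tperm i j k) :> lform R.
Proof.
by rewrite !canyE mul_block_col !mul0mx mulmx0 !add0r tperm_mx_delta.
Qed.

End Symplectic.

(** * Multiplicativity of beta *)

Section Beta.
Context {R : realType}.
Variable hbar : Cx R.
Implicit Types (v w : lform R) (m : monom R) (f g : Defs.series R).

(** [beta] is precomposition with the inverse map below; a single monomial is therefore moved by
    this one. *)
Definition beta_monom m : monom R :=
  (beta_mx *m m.1, beta_mx *m m.2 *m invmx beta_mx).

Definition beta_monom_inv m : monom R :=
  (invmx beta_mx *m m.1, invmx beta_mx *m m.2 *m beta_mx).

Lemma beta_monomK : cancel beta_monom beta_monom_inv.
Proof.
case=> v A; rewrite /beta_monom_inv /= mulKmx ?beta_mx_unit // -!mulmxA.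
by rewrite mulVmx ?beta_mx_unit // mulmx1 mulKmx ?beta_mx_unit.
Qed.

Lemma beta_monom_invK : cancel beta_monom_inv beta_monom.
Proof.
case=> v A; rewrite /beta_monom /= mulKVmx ?beta_mx_unit // -!mulmxA.
by rewrite mulmxV ?beta_mx_unit // mulmx1 mulKVmx ?beta_mx_unit.
Qed.

Lemma beta_monom_invM m m' :
  mmul (beta_monom_inv m) (beta_monom_inv m') = beta_monom_inv (mmul m m').
Proof.
rewrite /mmul /beta_monom_inv /= mulmxDr (conj_mulmx _ _ (beta_mx_unit R)).
by rewrite -[X in (_, _ *m X)]mulmxA (conj_mulmx _ _ (beta_mx_unit R)) !mulmxA.
Qed.

Lemma mcoef_beta_inv m m' :
  mcoef hbar (beta_monom_inv m) (beta_monom_inv m') = mcoef hbar m m'.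
Proof.
rewrite /mcoef /= (conj_mulmx _ _ (beta_mx_unit R)).
by rewrite -(omega_symplectic _ _ symplectic_beta) !mulKVmx ?beta_mx_unit.
Qed.

(** The monomial map is a bijection between the factorisations of m and those of its preimage, and
    it preserves the scalar [mcoef] because beta is symplectic. *)
Lemma beta_smul f g : beta (smul hbar f g) = smul hbar (beta f) (beta g).
Proof.
apply/funext => m; rewrite /beta /smul -/(beta_monom_inv m).
rewrite (reindex_fsbig (fun k => (beta_monom_inv k.1, beta_monom_inv k.2))
  [set k | mmul k.1 k.2 = m]) /=.
  by apply: eq_fsbigr => k _; rewrite mcoef_beta_inv.
split=> [k /= <-|k k' _ _ kk'|[k1 k2] /= k12].
- exact: beta_monom_invM.
- have /(can_inj beta_monom_invK) k1 := congr1 fst kk'.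
  have /(can_inj beta_monom_invK) k2 := congr1 snd kk'.
  by rewrite (surjective_pairing k) k1 k2 -surjective_pairing.
- exists (beta_monom k1, beta_monom k2) => /=; last by rewrite !beta_monomK.
  apply: (can_inj beta_monom_invK).
  by rewrite -beta_monom_invM !beta_monomK.
Qed.

Lemma beta_smonom c m : beta (smonom c m) = smonom c (beta_monom m).
Proof.
apply/funext => m'; rewrite /beta /smonom -/(beta_monom_inv m').
by rewrite (can2_eq beta_monom_invK beta_monomK).
Qed.

Lemma beta_sone : beta sone = sone :> Defs.series R.
Proof.
by rewrite /sone beta_smonom /beta_monom /= mulmx0 mulmx1 mulmxV ?beta_mx_unit.
Qed.

Lemma beta_sexp s v : beta (sexp s v) = sexp s (beta_mx *m v).
Proof. by rewrite beta_smonom /beta_monom /= mulmx1 mulmxV ?beta_mx_unit. Qed.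

Lemma beta_spow f n : beta (spow hbar f n) = spow hbar (beta f) n.
Proof. by elim: n => [|n IHn]; rewrite ?beta_sone // /spow !iterS beta_smul IHn. Qed.

Lemma beta_seval a f : beta (seval hbar a f) = seval hbar a (beta f).
Proof.
apply/funext => m; rewrite /beta /seval; apply: eq_fsbigr => n _.
by rewrite -beta_spow.
Qed.

End Beta.

(** * Comparison of the two sides under the specialization *)

Section Specialization.
Context {R : realType}.
Variable hbar : Cx R.

Lemma sexp2E v w : sexp2 v w = smonom 1 (0, transvection (@sympl R) v w).
Proof. by []. Qed.

Lemma srhoE i j : srho i j = smonom 1 (0, rho_mx i j) :> Defs.series R.
Proof. by []. Qed.

(** The right-hand side is P_SB. Both sides collapse to monomials with coefficient 1, leaving one
    identity of linear forms and one of matrices. *)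
Lemma beta_P_FG (th : 'I_3 -> Cx R) : beta (P_FG hbar th) =
  sprod hbar [:: sexp2 (canx o3 - canx o2) (cany o1);
    sexp 0 (((th o3 - th o2) / hbar) *: (canx o1 - canx o2)); srho o2 o3].
Proof.
rewrite /P_FG; cbv zeta; rewrite !sexp2E !srhoE /sexp cexp0.
rewrite sprod_act_act_exp sprod_act_exp_act beta_smonom.
rewrite /beta_monom /=.
(* The sign from beta p_1 = - w_1 and the sign from exchanging u_2 and u_3 cancel in the
   transvection. *)
have rho_p1 : beta_mx *m (rho_mx o2 o3 *m canx o1) = - cany o1 :> lform R.
  by rewrite rho_canx tpermD // beta_mx_p.
have rho_u23 : beta_mx *m (rho_mx o2 o3 *m (cany o3 - cany o2)) =
    - (canx o3 - canx o2) :> lform R.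
  by rewrite mulmxBr !rho_cany tpermL tpermR mulmxBr !beta_mx_u opprB.
have := transvection_conjM (canx o1 : lform R) (cany o3 - cany o2)
  symplectic_beta (symplectic_rho o2 o3) (rho_betaC o2 o3).
rewrite rho_p1 rho_u23 transvectionNN (transvectionC _ (cany o1)).
move=> /(intertwine_conj (((th o2 - th o3) / hbar) *: (cany o3 - cany o1))
  (beta_mx_unit R)) [-> ->].
have -> : rho_mx o2 o3 *m (beta_mx *m
      (((th o2 - th o3) / hbar) *: (cany o3 - cany o1))) =
    ((th o3 - th o2) / hbar) *: (canx o1 - canx o2) :> lform R.
  rewrite -!scalemxAr !mulmxBr !beta_mx_u !rho_canx tpermR tpermD //.
  by rewrite -opprB mulNr scaleNr -scalerN opprB.
by [].
Qed.

Lemma tends_ninftyDr (I : Type) (F : set_system I) {FF : Filter F}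
    (s : I -> Cx R) (c : Cx R) :
  tends_ninfty F s -> tends_ninfty F (fun t => s t + c).
Proof.
move=> /cvgrNyPlt s_ninfty; apply/cvgrNyPlt => A.
apply: filterS (s_ninfty (A - complex.Re c)) => t.
by rewrite ltrBrDr; case: (s t) c => [? ?] [? ?].
Qed.

Section SpecializedFactors.
Variables (th : 'I_3 -> Cx R) (z : bfly_params R).
Hypotheses (z_balanced : balanced z) (z_specialized : specialized th z).

(** The specialization makes a_i + c_i vanish for i = 1 and i = 3, so balancing becomes b_i = - (d_i
    + e_i); this and the next two lemmas express b_1, b_3, d_1 accordingly. *)
Lemma specialized_pb1 : pb z o1 = - (pd z o1 + pe z o1).
Proof.
have [_ [ac1 a3 c3] _ _] := z_specialized.
have := z_balanced o1; rewrite ac1 a3 c3 => E.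
by apply/eqP; rewrite -subr_eq0 opprK -{}E; apply/eqP; ring.
Qed.

Lemma specialized_pb3 : pb z o3 = - th o3.
Proof.
have [_ [_ a3 _] _ [_ _ ->]] := z_specialized.
have := z_balanced o3; rewrite -a3 => E.
by apply/eqP; rewrite -subr_eq0 opprK -{}E; apply/eqP; ring.
Qed.

Lemma specialized_pd1 : pd z o1 = th o1 - pe z o1.
Proof.
have [_ _ _ [-> _ _]] := z_specialized.
by rewrite specialized_pb1; ring.
Qed.

(** As e_2 = e_3, lambda_0 vanishes and its exponential is 1; moreover lambda_1 = - lambda_2 =
    theta_3 - theta_2 and lambda_3 = 0. *)
Lemma P_bfly_specialized : P_bfly hbar z = beta (P_FG hbar th).
Proof.
have [e23 [a13 _ c31] [a2 c2] [_ th2 _]] := z_specialized.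
rewrite beta_P_FG /P_bfly e23 subrr !mul0r; cbv zeta.
rewrite scale0r {1}/sexp cexp0 -/sone /sprod /= smul1l.
have -> : pa z o2 - pa z o3 + pb z o2 - pb z o3 + 0 = th o3 - th o2.
  by rewrite a2 th2 a13 specialized_pb3; ring.
have -> : - pa z o1 - pb z o2 + pb z o3 - 0 = - (th o3 - th o2).
  by rewrite th2 specialized_pb3; ring.
have -> : pc z o1 - pc z o2 + pc z o3 = 0 by rewrite c2 c31; ring.
rewrite scale0r addr0 scaleNr -scalerBr scalerA.
by rewrite [hbar^-1 * _]mulrC.
Qed.

(** Each scalar exponent other than the third is written as e_1, e_1 - e_3 or e_2 plus a constant in
    theta, the form to which [tends_ninftyDr] applies. *)
Lemma R_bfly_factors_specialized :
  let u := @canx R in let w := @cany R in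
  R_bfly_factors hbar z =
  [:: Psi_inv hbar (pe z o1 + (th o3 - th o1))
        (u o1 + u o3 + w o1 - w o2 + w o3);
      Psi_inv hbar (pe z o1 - pe z o3 + (th o3 - th o1))
        (u o1 - u o3 + w o1 - w o2 + w o3);
      Psi hbar (th o1 - th o3) (u o1 - u o3 - w o1 + w o2 - w o3);
      Psi hbar (pe z o2 + (th o1 - th o3))
        (u o1 + u o2 *+ 2 - u o3 - w o1 + w o2 - w o3);
      beta (P_FG hbar th)].
Proof.
move=> u w; have [_ _ [_ c2] _] := z_specialized.
rewrite /R_bfly_factors P_bfly_specialized; cbv zeta.
have s1 : - pd z o1 - pc z o2 - pb z o3 = pe z o1 + (th o3 - th o1).
  by rewrite c2 specialized_pd1 specialized_pb3; ring.
have -> : - pd z o1 - pc z o2 - pb z o3 - pe z o3 =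
    pe z o1 - pe z o3 + (th o3 - th o1) by rewrite s1; ring.
have -> : pd z o1 + pe z o1 + pc z o2 + pb z o3 = th o1 - th o3.
  by rewrite c2 specialized_pd1 specialized_pb3; ring.
have -> : pd z o1 + pe z o1 + pc z o2 + pe z o2 + pb z o3 =
    pe z o2 + (th o1 - th o3).
  by rewrite c2 specialized_pd1 specialized_pb3; ring.
by rewrite s1.
Qed.

End SpecializedFactors.

Lemma lead_canx i : lead (canx i : lform R) = (i == o1)%:R.
Proof. by rewrite /lead /canx mxE eq_lshift eqxx andbT eq_sym. Qed.

Lemma lead_cany i : lead (cany i : lform R) = 0.
Proof. by rewrite /lead /cany mxE eq_lrshift. Qed.

Lemma beta_R_FG (th : 'I_3 -> Cx R) :
  let u := @canx R in let w := @cany R in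
  beta (R_FG hbar th) =
  sprod hbar [:: Psi hbar (th o1 - th o3) (u o1 - u o3 - w o1 + w o2 - w o3);
                 beta (P_FG hbar th)].
Proof.
move=> u w.
have vE : beta_mx *m (canx o1 + cany o1 + canx o3 - cany o3 - canx o2) =
    u o1 - u o3 - w o1 + w o2 - w o3.
  rewrite !mulmxBr !mulmxDr !beta_mx_u !beta_mx_p opprK (addrC (- cany o1)).
  by rewrite (addrAC _ (- cany o3) (- canx o3)) (addrAC (canx o1))
    (addrAC _ (- cany o3)).
rewrite /R_FG; cbv zeta; rewrite /sprod /= !beta_smul beta_sone.
by rewrite /Psi beta_seval beta_sexp vE.
Qed.

End Specialization.

(** * Limit of the factors and of their product *)

Theorem theorem8p2 (R : realType) (hbar : Cx R) (q_lt1 : `|cexp hbar| < 1)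
    (th : 'I_3 -> Cx R)
    (I : Type) (F : set_system I) (FF : ProperFilter F)
    (z : I -> bfly_params R)
    (z_balanced : forall t, balanced (z t))
    (z_specialized : forall t, specialized th (z t))
    (e1_ninfty : tends_ninfty F (fun t => pe (z t) o1))
    (e2_ninfty : tends_ninfty F (fun t => pe (z t) o2))
    (e3_ninfty : tends_ninfty F (fun t => pe (z t) o3))
    (e13_ninfty : tends_ninfty F (fun t => pe (z t) o1 - pe (z t) o3))
    (ed_finite : forall i, bounded_near (fun t => pe (z t) i + pd (z t) i) F) :
  factor_lim hbar F (fun t => R_bfly_factors hbar (z t))
    (beta (R_FG hbar th)) /\
  coef_lim F (fun t => R_bfly hbar (z t)) (beta (R_FG hbar th)).
Proof.
have facE t := R_bfly_factors_specialized hbar (z_balanced t) (z_specialized t).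
have prodE t := congr1 (sprod hbar) (facE t).
rewrite /R_bfly (funext facE) (funext prodE) beta_R_FG.
set v1 := canx o1 + canx o3 + _ - _ + _; set v2 := canx o1 - _ + _ - _ + _.
set v3 := canx o1 - _ - _ + _ - _; set v4 := canx o1 + canx o2 *+ 2 - _ - _ + _ - _.
have inv0 : fps_inv (psi_q (cexp hbar)) 0%N = 1 by rewrite fps_inv0 psi_q0 invr1.
have [lead1 lead2 lead3 lead4] :
    [/\ lead v1 = 1, lead v2 = 1, lead v3 = 1 & lead v4 = 1].
  by split; rewrite /v1 /v2 /v3 /v4;
    rewrite !(leadD, leadN, leadMn, lead_canx, lead_cany) /= ?mul0rn; ring.
have lim1 : coef_lim F
    (fun t => Psi_inv hbar (pe (z t) o1 + (th o3 - th o1)) v1) sone.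
  by apply: seval_sexp_cvg1 => //; exact: tends_ninftyDr.
have lim2 : coef_lim F
    (fun t => Psi_inv hbar (pe (z t) o1 - pe (z t) o3 + (th o3 - th o1)) v2) sone.
  by apply: seval_sexp_cvg1 => //; exact: tends_ninftyDr.
have lim3 : coef_lim F (fun=> Psi hbar (th o1 - th o3) v3)
    (Psi hbar (th o1 - th o3) v3) by exact: coef_lim_cst.
have lim4 : coef_lim F (fun t => Psi hbar (pe (z t) o2 + (th o1 - th o3)) v4) sone.
  by apply: seval_sexp_cvg1 => //; [exact: psi_q0|exact: tends_ninftyDr].
(* The units are the limits of the first, second and fourth factors; they drop out of the product,
   which leaves the image of [R_FG]. *)
pose ls := [:: sone; sone; Psi hbar (th o1 - th o3) v3; sone; beta (P_FG hbar th)].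
have lsE : sprod hbar [:: Psi hbar (th o1 - th o3) v3; beta (P_FG hbar th)] =
    sprod hbar ls by rewrite /sprod /= !smul1l.
rewrite lsE; split.
  exists ls; split; [by []| |by []].
  (* The last two cases are P, constant in t, and the indices past the end, where both [nth] return
     the default [sone]. *)
  case=> [|[|[|[|[|k]]]]]; [exact: lim1|exact: lim2|exact: lim3|exact: lim4| |];
    exact: coef_lim_cst.
(* The fold in [sprod] ends with the unit, so its innermost product is a single monomial, whose
   u_1-coordinate is the base of the grading. *)
have [m PE] : exists m, smul hbar (beta (P_FG hbar th)) sone = smonom 1 m.
  rewrite beta_P_FG sexp2E srhoE /sexp cexp0 sprod_act_exp_act /sone smonomM_act.
  by rewrite mulr1; eexists.
rewrite /ls /sprod /= PE.
have lim5 : graded_lim F (lead m.1) (fun=> smonom 1 m) (smonom 1 m).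
  by split=> [t||]; [exact: smonom_lead_above..|exact: coef_lim_cst].
have F_filter : Filter F by exact: _.
have pow a s v := @seval_sexp_on_powers R hbar a s v.
(* The product is built from right to left, one power series in an exponential of lead 1 at a
   time. *)
have lim45 := graded_lim_smul (FF := F_filter) hbar lead4 (fun t => pow _ _ v4)
  (@sone_on_powers R v4) lim4 lim5.
have lim35 := graded_lim_smul (FF := F_filter) hbar lead3 (fun t => pow _ _ v3)
  (pow _ (th o1 - th o3) v3) lim3 lim45.
have lim25 := graded_lim_smul (FF := F_filter) hbar lead2 (fun t => pow _ _ v2)
  (@sone_on_powers R v2) lim2 lim35.
have lim15 := graded_lim_smul (FF := F_filter) hbar lead1 (fun t => pow _ _ v1)
  (@sone_on_powers R v1) lim1 lim25.
case: lim15 => _ _ lim_prod; exact: lim_prod.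
Qed.
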